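(* Let $D$ be an integral domain, $K$ the quotient field of $D$, let $L$ be an extension field of $K$ and let $X$ be an indeterminate over $L$. Then the following hold. (1) $D+XL[X]$ is condensed if and only if $D$ is condensed and $D\subseteq L$ is $sm$-closed. (2) If $D+XL[X]$ is condensed, then $[L:K]\leq 3$.
   Context: $D+XL[X]=\{f\in L[X] : f(0)\in D\}$. For an integral domain $R$ and nonzero ideals $I,J$ of $R$, the product $IJ$ is condensed if $IJ=\{ij : i\in I,\ j\in J\}$; $R$ is condensed if $IJ$ is condensed for every pair of nonzero ideals $I,J$ of $R$. For $D$-submodules $M,N$ of $L$, let $P(M,N)=\{mn : m\in M,\ n\in N\}$ and let $MN$ be the $D$-submodule of $L$ generated by $P(M,N)$. The extension $D\subseteq L$ is called $sm$-closed (submodule closed) if $P(M,N)=MN$ for every pair of two-generated $D$-submodules $M,N$ of $L$. *)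

(* Defs.v *)
From HB Require Import structures.
From mathcomp Require Import all_boot all_order all_algebra.
From mathcomp Require Import mathcomp_extra boolp classical_sets.
Set Implicit Arguments.
Unset Strict Implicit.
Unset Printing Implicit Defensive.
Import GRing.Theory.
Local Open Scope classical_set_scope.
Local Open Scope ring_scope.

(* [A]-submodules of [B], where [B] is an [A]-module through [f]. *)
Definition submodule (A B : comNzRingType) (f : {rmorphism A -> B})
    (M : set B) : Prop :=
  [/\ M 0,
      forall x y, M x -> M y -> M (x + y) &
      forall a x, M x -> M (f a * x)].

Definition gen_submodule (A B : comNzRingType) (f : {rmorphism A -> B})
    (S : set B) : set B :=
  smallest (submodule f) S.

Definition prodset (B : comNzRingType) (M N : set B) : set B :=
  [set x * y | x in M & y in N].

Definition ideal (R : idomainType) (I : set R) : Prop := submodule idfun I.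

Definition ideal_mul (R : idomainType) (I J : set R) : set R :=
  gen_submodule idfun (prodset I J).

Definition condensed (R : idomainType) : Prop :=
  forall I J : set R, ideal I -> ideal J -> I <> [set 0] -> J <> [set 0] ->
    ideal_mul I J = prodset I J.

(* "Two-generated" means generated by at most two elements: [a] and [b] may
   coincide or vanish. *)
Definition two_generated (D : idomainType) (L : fieldType)
    (f : {rmorphism D -> L}) (M : set L) : Prop :=
  exists a b : L, M = gen_submodule f [set a; b].

Definition sm_closed (D : idomainType) (L : fieldType)
    (f : {rmorphism D -> L}) : Prop :=
  forall M N : set L, two_generated f M -> two_generated f N ->
    prodset M N = gen_submodule f (prodset M N).

(* [[L : K] = n]; [L] is not a [fieldExtType], as those are finite-dimensional
   by definition. *)
Definition has_degree (K L : fieldType) (iota : {rmorphism K -> L}) (n : nat)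
    : Prop :=
  exists b : 'I_n -> L,
    forall x : L, exists! c : 'rV[K]_n, x = \sum_(i < n) iota (c 0 i) * b i.

Definition frac_embed (D : idomainType) (L : fieldType)
    (iota : {rmorphism {fraction D} -> L}) : {rmorphism D -> L} :=
  iota \o @tofrac D.

Definition DXL_pred (D : idomainType) (L : fieldType)
    (f : {rmorphism D -> L}) : {pred {poly L}} :=
  fun p => `[< exists d : D, p.[0] = f d >].

Fact DXL_subring_closed (D : idomainType) (L : fieldType)
    (f : {rmorphism D -> L}) : subring_closed (DXL_pred f).
Proof.
split=> [|p q /asboolP[d pd] /asboolP[e qe]|p q /asboolP[d pd] /asboolP[e qe]].
- by apply/asboolP; exists 1; rewrite hornerC rmorph1.
- by apply/asboolP; exists (d - e); rewrite hornerD hornerN pd qe rmorphB.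
- by apply/asboolP; exists (d * e); rewrite hornerM pd qe rmorphM.
Qed.

HB.instance Definition _ (D : idomainType) (L : fieldType)
    (f : {rmorphism D -> L}) :=
  GRing.isSubringClosed.Build {poly L} (DXL_pred f) (DXL_subring_closed f).

(* The ring [D + X L[X]], with [D] identified with its image under [f]. *)
Record DXL (D : idomainType) (L : fieldType) (f : {rmorphism D -> L}) :=
  MkDXL { DXL_val :> {poly L}; _ : DXL_val \in DXL_pred f }.

Section DXLStructure.
Variables (D : idomainType) (L : fieldType) (f : {rmorphism D -> L}).

HB.instance Definition _ := [isSub for @DXL_val D L f].
HB.instance Definition _ := [Choice of DXL f by <:].
HB.instance Definition _ := [SubChoice_isSubComNzRing of DXL f by <:].

(* The units are those of [DXL f], not the units of [{poly L}] lying in it. *)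
Definition DXL_unit : pred (DXL f) := fun x => `[< exists y, y * x = 1 >].

Definition DXL_inv (x : DXL f) : DXL f :=
  if pselect (exists y, y * x = 1) is left h then projT1 (cid h) else x.

Fact DXL_mulVr : {in DXL_unit, left_inverse 1 DXL_inv *%R}.
Proof.
by move=> x /asboolP xU; rewrite /DXL_inv; case: pselect => // h; case: cid.
Qed.

Fact DXL_unitPl (x y : DXL f) : y * x = 1 -> DXL_unit x.
Proof. by move=> yx; apply/asboolP; exists y. Qed.

Fact DXL_inv_out : {in [predC DXL_unit], DXL_inv =1 id}.
Proof. by move=> x /asboolPn xU; rewrite /DXL_inv; case: pselect. Qed.

HB.instance Definition _ :=
  GRing.ComNzRing_hasMulInverse.Build (DXL f)
    DXL_mulVr DXL_unitPl DXL_inv_out.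

Fact DXL_mulf_eq0 (x y : DXL f) : x * y = 0 -> (x == 0) || (y == 0).
Proof.
move=> /(congr1 val); rewrite rmorphM rmorph0 => /eqP.
by rewrite mulf_eq0 -!(inj_eq val_inj) rmorph0.
Qed.

HB.instance Definition _ :=
  GRing.ComUnitRing_isIntegral.Build (DXL f) DXL_mulf_eq0.

End DXLStructure.

(* Main.v *)
Require Import Defs.
From mathcomp Require Import all_boot all_order all_algebra.
From mathcomp Require Import boolp classical_sets.
From mathcomp Require Import ring.
Set Implicit Arguments.
Unset Strict Implicit.
Import GRing.Theory.
Local Open Scope ring_scope.

(** Both [condensed] and [sm_closed] amount to one elementwise condition: every
    sum [a c + b d] factors as [(x a + y b) (z c + w d)], with coefficients
    [x, y, z, w] in the base ring. For [D + X L[X]] the condition is transferred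
    to [L] by multiplying [a, b, c, d] by [X], and back by dividing out the gcds
    in [L[X]]: if [a, b] are coprime in [L[X]], the ideal of [D + X L[X]] that
    they generate consists of all [p] with [p(0)] in [D a(0) + D b(0)].
    For the degree, [1 + t u = (x + y t) (z + w u)] forces [1, t, u, t u] to be
    linearly dependent over [K]. If [t] is not in [K], this makes every [u] a
    quotient of two elements of [K + K t]; the case [u = t ^ 2] shows that [t]
    has degree at most 3 over [K]. *)

Local Open Scope classical_set_scope.

(** * Products of submodules and the factorization of sums *)

Definition sums_factor (A B : comNzRingType) (f : {rmorphism A -> B}) : Prop :=
  forall a b c d : B, exists x y z w : A,
    a * c + b * d = (f x * a + f y * b) * (f z * c + f w * d).

Section Submodules.
Variables (A B : comNzRingType) (f : {rmorphism A -> B}).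

Lemma gen_submoduleP (S : set B) : submodule f (gen_submodule f S).
Proof.
split=> [N [[]] //|x y Mx My N NS|a x Mx N NS].
  by case: (NS) => -[_ ND _] _; apply: ND; [apply: Mx|apply: My].
by case: (NS) => -[_ _ NZ] _; apply: NZ; apply: Mx.
Qed.

Lemma sub_gen_submodule (S : set B) : S `<=` gen_submodule f S.
Proof. by move=> x Sx N [_]; apply. Qed.

Lemma gen_submodule_id (M : set B) : submodule f M -> gen_submodule f M = M.
Proof.
move=> Mmod; apply/seteqP; split=> [x Mx|]; last exact: sub_gen_submodule.
by apply: Mx; split.
Qed.

Lemma gen_submodule2 (a b m : B) :
  gen_submodule f [set a; b] m -> exists x y, m = f x * a + f y * b.
Proof.
move=> abm; apply: (abm [set u | exists x y, u = f x * a + f y * b]).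
split=> [|_ [] ->]; first split.
- by exists 0, 0; rewrite rmorph0 !mul0r addr0.
- move=> _ _ [x [y ->]] [x' [y' ->]]; exists (x + x'), (y + y').
  by rewrite !rmorphD; ring.
- move=> k _ [x [y ->]]; exists (k * x), (k * y).
  by rewrite !rmorphM; ring.
- by exists 1, 0; rewrite rmorph0 rmorph1 mul0r mul1r addr0.
- by exists 0, 1; rewrite rmorph0 rmorph1 mul0r mul1r add0r.
Qed.

(** Only additivity needs [sums_factor], which turns a sum of two products into one product; 0 and
    scalar multiples are products already. *)
Lemma sums_factor_prodset (M N : set B) :
  sums_factor f -> submodule f M -> submodule f N ->
  gen_submodule f (prodset M N) = prodset M N.
Proof.
move=> fac [M0 MD MZ] [N0 ND NZ]; apply: gen_submodule_id; split.
- by exists 0 => //; exists 0 => //; rewrite mulr0.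
- move=> _ _ [a Ma [c Nc <-]] [b Mb [d Nd <-]].
  have [x [y [z [w ->]]]] := fac a b c d.
  exists (f x * a + f y * b); first by apply: MD; apply: MZ.
  by exists (f z * c + f w * d) => //; apply: ND; apply: NZ.
- move=> k _ [a Ma [c Nc <-]]; exists (f k * a); first exact: MZ.
  by exists c => //; rewrite mulrA.
Qed.

Lemma prodset_gen_factor (a b c d : B) :
  let M := gen_submodule f [set a; b] in
  let N := gen_submodule f [set c; d] in
  gen_submodule f (prodset M N) = prodset M N ->
  exists x y z w, a * c + b * d = (f x * a + f y * b) * (f z * c + f w * d).
Proof.
move=> M N MN.
have : prodset M N (a * c + b * d).
  rewrite -MN; have [_ MND _] := gen_submoduleP (prodset M N).
  apply: MND; apply: sub_gen_submodule.
    exists a; first by apply: sub_gen_submodule; left.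
    by exists c => //; apply: sub_gen_submodule; left.
  exists b; first by apply: sub_gen_submodule; right.
  by exists d => //; apply: sub_gen_submodule; right.
move=> [m /gen_submodule2[x [y ->]] [n /gen_submodule2[z [w ->]] <-]].
by exists x, y, z, w.
Qed.

End Submodules.

Lemma condensedP (R : idomainType) :
  condensed R <-> sums_factor (idfun : {rmorphism R -> R}).
Proof.
split=> [Rc a b c d|fac I J Iid Jid _ _]; last exact: sums_factor_prodset.
have zero u v : gen_submodule idfun [set u; v] = [set (0 : R)] ->
    u = 0 /\ v = 0.
  move=> uv0; have sub := @sub_gen_submodule _ _ idfun [set u; v].
  by rewrite uv0 in sub; split; apply: sub; [left|right].
(* [condensed] says nothing about zero ideals, but if either ideal is zero, its generators vanish
   and the sum to be factored is 0. *)
have [/zero[-> ->]|I0] := pselect (gen_submodule idfun [set a; b] = [set 0]).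
  by exists 0, 0, 0, 0; rewrite /=; ring.
have [/zero[-> ->]|J0] := pselect (gen_submodule idfun [set c; d] = [set 0]).
  by exists 0, 0, 0, 0; rewrite /=; ring.
apply: prodset_gen_factor; apply: Rc => //; exact: gen_submoduleP.
Qed.

Lemma sm_closedP (D : idomainType) (L : fieldType) (f : {rmorphism D -> L}) :
  sm_closed f <-> sums_factor f.
Proof.
split=> [sm a b c d|fac M N [a [b ->]] [c [d ->]]].
  by apply: prodset_gen_factor; apply/esym/sm; [exists a, b|exists c, d].
by apply/esym/sums_factor_prodset => //; exact: gen_submoduleP.
Qed.

(** * Transfer between [L] and [D + X L[X]] *)

Section DplusXLX.
Variables (D : idomainType) (L : fieldType) (f : {rmorphism D -> L}).

Lemma DXL_horner0 (p : DXL f) : exists d, (val p).[0] = f d.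
Proof. by apply/asboolP; exact: (valP p). Qed.

Lemma DXL_lift (p : {poly L}) (d : D) :
  p.[0] = f d -> exists q : DXL f, val q = p.
Proof.
by move=> pd; have h : p \in DXL_pred f by [apply/asboolP; exists d];
   exists (MkDXL h).
Qed.

Lemma val_sum_factorE (a b c d x y z w : DXL f) :
  a * c + b * d = (x * a + y * b) * (z * c + w * d) <->
  val a * val c + val b * val d =
    (val x * val a + val y * val b) * (val z * val c + val w * val d).
Proof.
by split=> [/(congr1 val)|E]; [|apply: val_inj]; rewrite !(rmorphD, rmorphM).
Qed.

Lemma sums_factor_DXL_base :
  sums_factor (idfun : {rmorphism DXL f -> DXL f}) -> sums_factor f.
Proof.
move=> fac a b c d.
have lift (u : L) : exists q : DXL f, val q = u%:P * 'X.
  by apply: (@DXL_lift _ 0); rewrite hornerMX mulr0 rmorph0.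
have [[a' aE] [b' bE]] := (lift a, lift b).
have [[c' cE] [d' dE]] := (lift c, lift d).
have [x [y [z [w /val_sum_factorE]]]] := fac a' b' c' d'.
rewrite aE bE cE dE => facE.
have [[x0 x0E] [y0 y0E]] := (DXL_horner0 x, DXL_horner0 y).
have [[z0 z0E] [w0 w0E]] := (DXL_horner0 z, DXL_horner0 w).
exists x0, y0, z0, w0; rewrite -x0E -y0E -z0E -w0E.
(* Cancelling ['X ^+ 2] and evaluating at 0 leaves only the constant terms of the coefficients,
   which come from [D]. *)
have /(mulIf (monic_neq0 (monicXn L 2)))/(congr1 (horner^~ 0)) :
  (a%:P * c%:P + b%:P * d%:P) * 'X ^+ 2 =
  (val x * a%:P + val y * b%:P) * (val z * c%:P + val w * d%:P) * 'X ^+ 2.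
  by transitivity (a%:P * 'X * (c%:P * 'X) + b%:P * 'X * (d%:P * 'X));
     [|rewrite facE]; ring.
by rewrite /= !hornerE.
Qed.

(** The difference of [p] and [x0 a + y0 b] vanishes at 0, so it is [q X = q X (u a + v b)]; the
    coefficients [q X u + x0] and [q X v + y0] have constant terms in [D]. *)
Lemma coprime_DXL_span (a b u v p : {poly L}) (x0 y0 : D) :
  u * a + v * b = 1 -> p.[0] = f x0 * a.[0] + f y0 * b.[0] ->
  exists x y : DXL f, p = val x * a + val y * b.
Proof.
move=> uv1 p0.
have /factor_theorem[q] : root (p - ((f x0)%:P * a + (f y0)%:P * b)) 0.
  by rewrite rootE !hornerE p0 subrr.
rewrite subr0 => /eqP; rewrite subr_eq => /eqP pE.
have lift (e : D) (s : {poly L}) :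
    exists x : DXL f, val x = q * 'X * s + (f e)%:P.
  by apply: (@DXL_lift _ e); rewrite !hornerE.
have [[x xE] [y yE]] := (lift x0 u, lift y0 v).
exists x, y; rewrite xE yE pE -[q * 'X in LHS]mulr1 -uv1.
by ring.
Qed.

Lemma polys_coprime_factor (a b : {poly L}) :
  ~~ ((a == 0) && (b == 0)) ->
  exists g a' b' u v, [/\ a = g * a', b = g * b' & u * a' + v * b' = 1].
Proof.
move=> ab0; set g := gcdp a b.
have g0 : g != 0 by rewrite gcdp_eq0.
have /dvdpP[a' aE] : g %| a := dvdp_gcdl a b.
have /dvdpP[b' bE] : g %| b := dvdp_gcdr a b.
have [[u v] /= /eqpP[[k l] /= /andP[k0 l0] uvE]] := Bezoutp a b.
(* [Bezoutp] yields the gcd only up to nonzero scalars; the factor [k / l] corrects this. *)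
exists g, a', b', ((k / l) *: u), ((k / l) *: v).
split; [by rewrite mulrC|by rewrite mulrC|apply: (mulIf g0)].
rewrite mul1r -/g mulrDl -!scalerAl -!mulrA -aE -bE -scalerDr mulrC -scalerA.
by rewrite uvE scalerA mulVf // scale1r.
Qed.

(** Once the gcds [g] and [h] are divided out, the remaining sum [e] is split as [(e / B) * B] with
    [B] a nonzero constant. By [coprime_DXL_span], only the constant terms of the two factors
    matter. *)
Lemma sums_factor_DXL :
  sums_factor f -> sums_factor (idfun : {rmorphism DXL f -> DXL f}).
Proof.
move=> fac a b c d.
have [/andP[/eqP a0 /eqP b0]|ab0] :=
  boolP ((val a == 0) && (val b == 0)).
  by exists 0, 0, 0, 0; apply/val_sum_factorE; rewrite a0 b0 rmorph0; ring.
have [/andP[/eqP c0 /eqP d0]|cd0] :=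
  boolP ((val c == 0) && (val d == 0)).
  by exists 0, 0, 0, 0; apply/val_sum_factorE; rewrite c0 d0 rmorph0; ring.
have [g [a' [b' [u [v [aE bE uv1]]]]]] := polys_coprime_factor ab0.
have [h [c' [d' [s [t [cE dE st1]]]]]] := polys_coprime_factor cd0.
pose e := a' * c' + b' * d'.
have [x0 [y0 [z0 [w0 [B0 eB]]]]] : exists x y z w,
    let B := f z * c'.[0] + f w * d'.[0] in
    B != 0 /\ e.[0] / B = f x * a'.[0] + f y * b'.[0].
  have [x [y [z [w]]]] := fac a'.[0] b'.[0] c'.[0] d'.[0].
  have -> : a'.[0] * c'.[0] + b'.[0] * d'.[0] = e.[0] by rewrite !hornerE.
  set F := f x * _ + _; set G := f z * _ + _ => eFG.
  have [e0|e0] := eqVneq e.[0] 0; last first.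
    have G0 : G != 0 by apply: contraNneq e0 => G0; rewrite eFG G0 mulr0.
    by exists x, y, z, w; split=> //; rewrite eFG mulfK.
  (* If [e] vanishes at 0, any nonzero [B] will do; one exists because coprime [c'] and [d'] cannot
     both vanish at 0. *)
  suff [z' [w' B0]] : exists z w, f z * c'.[0] + f w * d'.[0] != 0.
    by exists 0, 0, z', w'; split=> //; rewrite e0 mul0r rmorph0 !mul0r addr0.
  have [c0|c0] := eqVneq c'.[0] 0; last first.
    by exists 1, 0; rewrite rmorph0 rmorph1 mul1r mul0r addr0.
  exists 0, 1; rewrite rmorph0 rmorph1 mul1r mul0r add0r.
  apply: contra_eq_neq st1 => d0; apply/eqP => /(congr1 (horner^~ 0)).
  rewrite hornerD !hornerM hornerC c0 d0 !mulr0 addr0 => /eqP.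
  by rewrite eq_sym oner_eq0.
pose B := f z0 * c'.[0] + f w0 * d'.[0].
have [x [y pE]] : exists x y : DXL f, B^-1 *: e = val x * a' + val y * b'.
  by apply: (coprime_DXL_span (x0 := x0) (y0 := y0) uv1); rewrite hornerZ mulrC.
have [z [w qE]] : exists z w : DXL f, B%:P = val z * c' + val w * d'.
  by apply: (coprime_DXL_span (x0 := z0) (y0 := w0) st1); rewrite hornerC.
exists x, y, z, w; apply/val_sum_factorE; rewrite aE bE cE dE.
transitivity (g * h * e); first by rewrite /e; ring.
transitivity (g * h * ((B^-1 *: e) * B%:P)).
  by rewrite mulrC [_ * B%:P]mulrC mul_polyC scalerA divff // scale1r mulrC.
by rewrite pE qE; ring.
Qed.

End DplusXLX.

(** * The degree of [L] over [K] *)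

Section Degree.
Variables (K L : fieldType) (iota : {rmorphism K -> L}).

Local Notation "p ^i" := (map_poly iota p) (at level 2, format "p ^i").

Lemma sums_factor_quotient (t : L) : sums_factor iota ->
  ~ (exists k, t = iota k) -> forall u, exists p q : {poly K},
  [/\ (size p <= 2)%N, (size q <= 2)%N, q^i.[t] != 0 & u * q^i.[t] = p^i.[t]].
Proof.
move=> fac tK u.
have lin (a b : K) : iota a + iota b * t = 0 -> a = 0 /\ b = 0.
  move=> /eqP; rewrite addrC addr_eq0 => /eqP abE.
  have [b0|b0] := eqVneq b 0.
    move/eqP: abE; rewrite b0 rmorph0 mul0r eq_sym oppr_eq0 fmorph_eq0.
    by move=> /eqP ->.
  case: tK; exists (- a / b); rewrite rmorphM fmorphV rmorphN -abE mulrC.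
  by rewrite mulKf // fmorph_eq0.
have [x [y [z [w]]]] := fac 1 t 1 u.
rewrite !mulr1 => facE.
pose lp (a b : K) : {poly K} := a%:P + b%:P * 'X.
have size_lp a b : (size (lp a b) <= 2)%N.
  rewrite (leq_trans (size_polyD _ _)) // geq_max.
  rewrite (leq_trans (size_polyC_leq1 _)) //=.
  rewrite (leq_trans (size_polyMleq _ _)) // size_polyX addn2 /= ltnS.
  exact: size_polyC_leq1.
have lpE a b : (lp a b)^i.[t] = iota a + iota b * t.
  by rewrite /lp rmorphD rmorphM /= !map_polyC map_polyX !hornerE.
(* This is [1 + t u = (x + y t) (z + w u)] solved for [u]. *)
have E : u * (iota (x * w) + iota (y * w - 1) * t) =
    iota (1 - x * z) + iota (- (y * z)) * t.
  rewrite !(rmorphB, rmorphN, rmorphM, rmorph1); apply: subr0_eq.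
  by rewrite -(subrr (1 + t * u)) {1}facE; ring.
exists (lp (1 - x * z) (- (y * z))), (lp (x * w) (y * w - 1)).
rewrite !size_lp !lpE; split=> //; apply/eqP => q0.
(* If the denominator vanishes, so does the numerator, and [x w = 0], [y w = 1], [x z = 1] are
   incompatible. *)
have [xw0 /subr0_eq yw1] := lin _ _ q0.
move: E; rewrite q0 mulr0 => /esym/lin[/subr0_eq xz1 _].
have /eqP : x * w * (y * z) = 1.
  by transitivity (x * z * (y * w)); [ring|rewrite -xz1 yw1 mulr1].
by rewrite xw0 mul0r eq_sym oner_eq0.
Qed.

(** The gcd of [m] and [q] does not vanish at [t], so its cofactor in [m] does. By minimality that
    cofactor is as large as [m], hence the gcd is constant and a Bezout relation evaluated at [t]
    gives the inverse. *)
Lemma minimal_poly_inv (m q : {poly K}) (t : L) :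
  m != 0 -> root m^i t ->
  (forall p, p != 0 -> root p^i t -> (size m <= size p)%N) ->
  q^i.[t] != 0 -> exists s, s^i.[t] * q^i.[t] = 1.
Proof.
move=> m0 mt m_min qt0.
have /dvdpP[e eE] : gcdp m q %| m := dvdp_gcdl m q.
have /dvdpP[e' e'E] : gcdp m q %| q := dvdp_gcdr m q.
have e0 : e != 0 by apply: contraNneq m0 => e0; rewrite eE e0 mul0r.
have g0 : gcdp m q != 0 by apply: contraNneq m0 => g0; rewrite eE g0 mulr0.
have gt0 : (gcdp m q)^i.[t] != 0.
  by apply: contraNneq qt0 => g0t; rewrite e'E rmorphM hornerM g0t mulr0.
have et : root e^i t.
  move: mt; rewrite eE rmorphM rootM [root (gcdp _ _)^i t]rootE.
  by rewrite (negPf gt0) orbF.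
have : coprimep m q.
  have := m_min e e0 et; rewrite /coprimep {1}eE size_mul // -subn1 leq_subLR.
  rewrite addnC leq_add2r => g1.
  by rewrite eqn_leq g1 lt0n size_poly_eq0.
move=> /Bezout_eq1_coprimepP[[u v] /= uv1].
exists v; have /(congr1 (fun p => p^i.[t])) := uv1.
rewrite rmorphD !rmorphM /= rmorph1 !hornerE.
by move: mt; rewrite rootE => /eqP ->; rewrite mulr0 add0r.
Qed.

(** The powers of [t] below the degree of [m] form a basis: division by [m] shows that they span,
    minimality of [m] that they are independent. *)
Lemma has_degree_powers (m : {poly K}) (t : L) :
  m != 0 -> root m^i t ->
  (forall p, p != 0 -> root p^i t -> (size m <= size p)%N) ->
  (forall u, exists p, u = p^i.[t]) -> has_degree iota (size m).-1.
Proof.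
move=> m0 mt m_min t_gen.
have lt_size (p : {poly K}) : (size p <= (size m).-1)%N -> (size p < size m)%N.
  by move=> /leq_ltn_trans; apply; rewrite prednK // lt0n size_poly_eq0.
have sumE (c : 'rV[K]_(size m).-1) :
    \sum_i iota (c 0 i) * t ^+ i = (rVpoly c)^i.[t].
  rewrite (@horner_coef_wide _ (size m).-1) ?size_map_poly ?size_poly //.
  by apply: eq_bigr => i _; rewrite coef_map coef_rVpoly_ord.
exists (fun i => t ^+ i) => u; have [p ->] := t_gen u.
have modE : p^i.[t] = (p %% m)^i.[t].
  rewrite {1}(divp_eq p m) rmorphD rmorphM hornerD hornerM.
  by move: mt; rewrite rootE => /eqP ->; rewrite mulr0 add0r.
have mod_size : (size (p %% m)%R <= (size m).-1)%N.
  by rewrite -ltnS prednK ?ltn_modp // lt0n size_poly_eq0.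
exists (poly_rV (p %% m)); split; first by rewrite sumE poly_rV_K.
move=> c; rewrite sumE modE => modcE; apply: (can_inj rVpolyK).
rewrite poly_rV_K //; apply/eqP; rewrite -subr_eq0; apply/negP => /negP d0.
have := m_min _ d0; rewrite rootE rmorphB hornerD hornerN modcE subrr eqxx.
move=> /(_ isT); rewrite leqNgt => /negP; apply; apply: lt_size.
rewrite (leq_trans (size_polyD _ _)) // geq_max size_polyN mod_size.
exact: size_poly.
Qed.

Lemma sums_factor_degree :
  sums_factor iota -> exists2 n, has_degree iota n & (n <= 3)%N.
Proof.
move=> fac; have [K_L|] := pselect (forall t, exists k, t = iota k).
  exists 1%N => //; exists (fun=> 1) => t; have [k ->] := K_L t.
  exists (\row_i k); split; first by rewrite big_ord1 mxE mulr1.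
  move=> c; rewrite big_ord1 mulr1 => /fmorph_inj ->.
  by apply/rowP => i; rewrite mxE; congr (c 0 _); rewrite !ord1.
move=> /existsNP[t tK].
have quot := sums_factor_quotient fac tK.
have [m m0 [mt m4]] : exists2 m, m != 0 & root m^i t /\ (size m <= 4)%N.
  have [p [q [p2 q2 qt0 pqE]]] := quot (t ^+ 2).
  have q0 : q != 0 by apply: contraNneq qt0 => ->; rewrite rmorph0 horner0.
  have sX2q : size (q * 'X^2) = (size q).+2 by rewrite size_mulXn.
  exists (q * 'X^2 - p).
    rewrite subr_eq0; apply: contraTneq p2 => <-.
    by rewrite sX2q -ltnNge !ltnS lt0n size_poly_eq0.
  split.
    rewrite rootE rmorphB rmorphM /= map_polyXn hornerD hornerN hornerM.
    by rewrite hornerXn mulrC pqE subrr.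
  rewrite (leq_trans (size_polyD _ _)) // geq_max size_polyN sX2q !ltnS q2.
  exact: leq_trans p2 _.
pose P n := `[< exists p, [/\ p != 0, root p^i t & size p = n] >].
have exP : exists n, P n by exists (size m); apply/asboolP; exists m.
have [n /asboolP[m' [m'0 m't m'n]] n_min] := ex_minnP exP.
have m'_min p : p != 0 -> root p^i t -> (size m' <= size p)%N.
  by move=> p0 pt; rewrite m'n; apply: n_min; apply/asboolP; exists p.
exists (size m').-1; last first.
  by rewrite -subn1 leq_subLR; apply: leq_trans m4; exact: m'_min.
(* Each [u] is a quotient [p(t) / q(t)], and [1 / q(t)] is a polynomial in [t], so [L = K[t]]. *)
apply: (has_degree_powers m'0 m't m'_min) => u.
have [p [q [_ _ qt0 uE]]] := quot u.
have [s sq1] := minimal_poly_inv m'0 m't m'_min qt0.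
exists (p * s); rewrite rmorphM hornerM -uE -mulrA [X in _ * X]mulrC sq1.
by rewrite mulr1.
Qed.

End Degree.

Theorem corollary7 (D : idomainType) (L : fieldType)
    (iota : {rmorphism {fraction D} -> L}) :
  (condensed (DXL (frac_embed iota)) <->
     condensed D /\ sm_closed (frac_embed iota)) /\
  (condensed (DXL (frac_embed iota)) ->
     exists2 n : nat, has_degree iota n & (n <= 3)%N).
Proof.
have f_inj : injective (frac_embed iota).
  by move=> x y /fmorph_inj/eqP; rewrite tofrac_eq => /eqP.
rewrite sm_closedP !condensedP; split=> [|/sums_factor_DXL_base fac].
  split=> [/sums_factor_DXL_base fac|[_ fac]]; last exact: sums_factor_DXL.
  (* [D] inherits the condition from [L]: the coefficients already lie in [D], and the identity
     pulls back along the injection. *)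
  split=> // a b c d.
  have [x [y [z [w E]]]] :=
    fac (frac_embed iota a) (frac_embed iota b)
        (frac_embed iota c) (frac_embed iota d).
  by exists x, y, z, w; apply: f_inj; rewrite !(rmorphD, rmorphM).
(* Coefficients from [D] are in particular coefficients from its fraction field. *)
apply: sums_factor_degree => a b c d; have [x [y [z [w E]]]] := fac a b c d.
by exists (tofrac x), (tofrac y), (tofrac z), (tofrac w).
Qed.
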